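(* Let $K_1,K_2,C_{111},C_{112},C_{122},C_{222}\in\mathbb{R}$ be constants. Consider the system $$\frac{\partial}{\partial t} D_y + \frac{\partial}{\partial x} B_z =0,\quad \frac{\partial}{\partial t} D_z - \frac{\partial}{\partial x} B_y =0,\quad \frac{\partial}{\partial t} B_y - \frac{\partial}{\partial x} E_z =0,\quad \frac{\partial}{\partial t} B_z + \frac{\partial}{\partial x} E_y =0 \qquad (\ast)$$ for functions $D_y,D_z,B_y,B_z$ of $(x,t)$, where $$E_y = K_1 D_y + 3 C_{111} D_y^2 + 2 C_{112} D_yD_z + C_{122} D_z^2,\qquad E_z = K_2 D_z + C_{112} D_y^2 + 2 C_{122} D_yD_z + 3 C_{222} D_z^2 .$$ Let $u=(D_y,D_z,B_y,B_z)$. Then there is a matrix function $a=a(u)$ such that $(\ast)$ is equivalent to $$\frac{\partial}{\partial t}u + a(u)\frac{\partial}{\partial x}u = 0 .\qquad (\ast\ast)$$ Moreover, under the assumption $0<K_2<K_1<1$, there is a $\delta>0$ such that the system $(\ast\ast)$ is uniformly strictly hyperbolic on $B^4_\delta(0)$. Finally, (under this assumption) $(\ast\ast)$ is genuinely non-linear whenever $C_{111}$ and $C_{222}$ are non-zero.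
   Context: $(\ast)$ are the Maxwell equations for plane waves travelling in the $x$-direction in a non-dispersive, non-magnetic homogeneous insulating crystal with energy density $\mathcal E=\frac12 B_y^2+\frac12 B_z^2+\frac12K_1D_y^2+\frac12K_2D_z^2+C_{111}D_y^3+C_{112}D_y^2D_z+C_{122}D_yD_z^2+C_{222}D_z^3$, with $E=\partial\mathcal E/\partial D$. $B^4_\delta(0)$ is the open ball of radius $\delta$ about $0$ in $\mathbb{R}^4$. Uniformly strictly hyperbolic on a ball $B$: for each $v\in B$ the matrix $a(v)$ has four real distinct eigenvalues $\lambda_4(v)<\lambda_3(v)<\lambda_2(v)<\lambda_1(v)$, and $\min_{k<l}\bigl(\inf_{v\in B}\lambda_k(v)-\sup_{v\in B}\lambda_l(v)\bigr)>0$. Genuinely non-linear (around the trivial solution $u\equiv0$): for each $i\in\{1,\ldots,4\}$, the directional derivative at $0$ of the eigenvalue $\lambda_i$ in the direction of an eigenvector $e_i(0)\neq0$ of $a(0)$ for $\lambda_i(0)$ is non-zero, i.e. $d\lambda_i(0)e_i(0)\neq0$. *)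

(* Defs.v *)
From HB Require Import structures.
From mathcomp Require Import all_boot all_order all_algebra.
From mathcomp Require Import all_classical all_reals all_analysis.

Set Implicit Arguments.
Unset Strict Implicit.
Unset Printing Implicit Defensive.

Import Order.TTheory GRing.Theory Num.Theory.
Import numFieldNormedType.Exports.

Local Open Scope classical_set_scope.
Local Open Scope ring_scope.

Definition E_y (R : realType) (K1 C111 C112 C122 Dy Dz : R) : R :=
  K1 * Dy + 3 * C111 * Dy ^+ 2 + 2 * C112 * Dy * Dz + C122 * Dz ^+ 2.

Definition E_z (R : realType) (K2 C112 C122 C222 Dy Dz : R) : R :=
  K2 * Dz + C112 * Dy ^+ 2 + 2 * C122 * Dy * Dz + 3 * C222 * Dz ^+ 2.

(* Functions of (x, t) are curried with x first. *)
Definition dx (R : realType) (V : normedModType R) (f : R -> R -> V)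
  (x t : R) : V := derive1 (fun y => f y t) x.

Definition dt (R : realType) (V : normedModType R) (f : R -> R -> V)
  (x t : R) : V := derive1 (fun s => f x s) t.

(* Since [derive1] is total, existence of the partial derivatives has to be
   required separately. *)
Definition has_partials (R : realType) (V : normedModType R)
    (f : R -> R -> V) (x t : R) : Prop :=
  derivable (fun y => f y t) x 1 /\ derivable (fun s => f x s) t 1.

Definition maxwell (R : realType) (K1 K2 C111 C112 C122 C222 : R)
    (Dy Dz By Bz : R -> R -> R) (x t : R) : Prop :=
  [/\ dt Dy x t + dx Bz x t = 0,
      dt Dz x t - dx By x t = 0,
      dt By x t
        - dx (fun y s => E_z K2 C112 C122 C222 (Dy y s) (Dz y s)) x t = 0
    & dt Bz x t
        + dx (fun y s => E_y K1 C111 C112 C122 (Dy y s) (Dz y s)) x t = 0].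

Definition state (R : realType) (Dy Dz By Bz : R -> R -> R) (x t : R) :
    'cV[R]_4 :=
  \col_(i < 4) [:: Dy x t; Dz x t; By x t; Bz x t]`_i.

Definition quasilinear (R : realType) (a : 'cV[R]_4 -> 'M[R]_4)
    (u : R -> R -> 'cV[R]_4) (x t : R) : Prop :=
  dt u x t + a (u x t) *m dx u x t = 0.

(* The Euclidean ball; the library's [ball] on matrices is that of the sup
   norm. *)
Definition euclidean_ball (R : realType) (n : nat) (delta : R) :
    set 'cV[R]_n :=
  [set v : 'cV[R]_n | Num.sqrt (\sum_i v i 0 ^+ 2) < delta].

(* [lam 0 v > lam 1 v > lam 2 v > lam 3 v] are the eigenvalues of [a v]; this
   determines [lam] on [B].  The library's [eigenvalue] is defined through row
   eigenvectors, but a square matrix and its transpose have the same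
   eigenvalues. *)
Definition ordered_eigenvalues (R : realType) (a : 'cV[R]_4 -> 'M[R]_4)
    (B : set 'cV[R]_4) (lam : 'I_4 -> 'cV[R]_4 -> R) : Prop :=
  forall v, B v ->
    (forall i, eigenvalue (a v) (lam i v)) /\
    (forall k l : 'I_4, (k < l)%N -> lam l v < lam k v).

(* Infima and suprema are taken in the extended reals, so that an unbounded
   eigenvalue does not get a default value. *)
Definition uniformly_strictly_hyperbolic (R : realType)
    (a : 'cV[R]_4 -> 'M[R]_4) (B : set 'cV[R]_4) : Prop :=
  exists lam : 'I_4 -> 'cV[R]_4 -> R,
    ordered_eigenvalues a B lam /\
    (0 < \big[Order.min/+oo]_(p : 'I_4 * 'I_4 | (p.1 < p.2)%N)
           (ereal_inf [set (lam p.1 v)%:E | v in B]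
            - ereal_sup [set (lam p.2 v)%:E | v in B]))%E.

(* Here the eigenvectors are column vectors. *)
Definition genuinely_nonlinear (R : realType)
    (a : 'cV[R]_4 -> 'M[R]_4) : Prop :=
  exists (U : set 'cV[R]_4) (lam : 'I_4 -> 'cV[R]_4 -> R),
    [/\ nbhs (0 : 'cV[R]_4) U,
        ordered_eigenvalues a U lam
      & forall i, differentiable (lam i) 0 /\
          forall e : 'cV[R]_4, e != 0 -> a 0 *m e = lam i 0 *: e ->
            'd (lam i) 0 e != 0].

(* Main.v *)
Require Import Defs.
From mathcomp Require Import all_boot all_order all_algebra.
From mathcomp Require Import all_classical all_reals all_analysis.
From mathcomp Require Import ring lra.
Import Order.TTheory GRing.Theory Num.Theory.
Import numFieldNormedType.Exports.
Local Open Scope classical_set_scope.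
Local Open Scope ring_scope.

(** Let [H = (p q; q r)] be the Hessian of the energy density in [(D_y, D_z)].
    By the chain rule, d/dx E = H (d/dx D), so the Maxwell equations are
    u_t + a(u) u_x = 0 with a(u) the matrix [symbol p q r] below
    ([maxwell_quasilinear]).  Eliminating the two magnetic components from
    a e = l e leaves H (e_0, e_1) = l^2 (e_0, e_1).  The eigenvalues of a are
    therefore the four numbers +- sqrt mu, where mu runs through the two
    eigenvalues of the symmetric matrix H, for which the quadratic formula
    gives explicit expressions ([sym2_eigenvalue], [speed]).

    At u = 0 the matrix H is diagonal with entries K1 > K2 > 0.  So the four
    speeds at 0 are sqrt K1 > sqrt K2 > - sqrt K2 > - sqrt K1, and near 0 the
    speeds are differentiable, because the arguments of all square roots stay
    positive.  Uniform strict hyperbolicity on a small ball follows from the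
    continuity of the speeds at 0 and their strict ordering there
    ([uniformly_strictly_hyperbolic_near]).

    For genuine non-linearity, the off-diagonal entry q vanishes at 0 and
    enters the discriminant (p - r)^2 + 4 q^2 only through its square.  To first
    order the eigenvalues of H are hence p and r, and the speeds +- sqrt K1
    and +- sqrt K2 have derivative dp / (2 l) and dr / (2 l)
    ([is_diff_speed]).  An eigenvector for l^2 = K1 has e_1 = 0, e_0 <> 0
    ([speed_eigenvector]), on which dp = 6 C111 e_0; one for l^2 = K2 has
    e_0 = 0, e_1 <> 0, on which dr = 6 C222 e_1. *)

(** * Linear algebra of the coefficient matrix *)

Lemma ord4P (P : 'I_4 -> Prop) : P 0 -> P 1 -> P 2 -> P 3 -> forall i, P i.
Proof.
move=> P0 P1 P2 P3 [[|[|[|[|//]]]] hi].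
- by rewrite (_ : Ordinal hi = 0) //; apply/val_inj.
- by rewrite (_ : Ordinal hi = 1) //; apply/val_inj.
- by rewrite (_ : Ordinal hi = 2) //; apply/val_inj.
- by rewrite (_ : Ordinal hi = 3) //; apply/val_inj.
Qed.

Lemma col4P {R : realType} (u w : 'cV[R]_4) :
  u = w <-> [/\ u 0 0 = w 0 0, u 1 0 = w 1 0, u 2 0 = w 2 0 & u 3 0 = w 3 0].
Proof.
split=> [->//|[h0 h1 h2 h3]]; apply/matrixP => i j; rewrite ord1.
by elim/ord4P: i.
Qed.

(** The coefficient matrix of the system in the variables
    [(D_y, D_z, B_y, B_z)], when the Jacobian of [E] with respect to [D] is
    [(p q; q r)]. *)
Definition symbol {R : realType} (p q r : R) : 'M[R]_4 :=
  \matrix_(i < 4, j < 4)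
    (nth [::] [:: [:: 0; 0; 0; 1];
                  [:: 0; 0; -1; 0];
                  [:: - q; - r; 0; 0];
                  [:: p; q; 0; 0]] i)`_j.

Lemma symbol_mul_col {R : realType} (p q r : R) (e : 'cV[R]_4) :
  [/\ (symbol p q r *m e) 0 0 = e 3 0,
      (symbol p q r *m e) 1 0 = - e 2 0,
      (symbol p q r *m e) 2 0 = - (q * e 0 0 + r * e 1 0)
    & (symbol p q r *m e) 3 0 = p * e 0 0 + q * e 1 0].
Proof.
have E i : (symbol p q r *m e) i 0 = symbol p q r i 0 * e 0 0 +
  symbol p q r i 1 * e 1 0 + symbol p q r i 2 * e 2 0 +
  symbol p q r i 3 * e 3 0.
  rewrite mxE !big_ord_recr big_ord0 /= add0r.
  by do ![congr (_ + _)]; congr (symbol p q r i _ * e _ 0); exact: val_inj.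
by rewrite !E !mxE /=; split; ring.
Qed.

Lemma symbol_system {R : realType} (p q r : R) (w e : 'cV[R]_4) :
  w + symbol p q r *m e = 0 <->
  [/\ w 0 0 + e 3 0 = 0, w 1 0 - e 2 0 = 0,
      w 2 0 - (q * e 0 0 + r * e 1 0) = 0
    & w 3 0 + (p * e 0 0 + q * e 1 0) = 0].
Proof.
have [S0 S1 S2 S3] := symbol_mul_col p q r e.
have addE i : (w + symbol p q r *m e) i 0 = w i 0 + (symbol p q r *m e) i 0.
  by rewrite mxE.
by rewrite col4P !addE S0 S1 S2 S3 !mxE.
Qed.

(** [l ^+ 2] is an eigenvalue of [(p q; q r)] by hypothesis.  From an eigenvector
    [(s, t)] of that symmetric matrix, the row vector [(l s, l t, - t, s)] is a
    left eigenvector of [symbol p q r] for [l]. *)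
Lemma eigenvalue_symbol {R : realType} (p q r l : R) :
  (p - l ^+ 2) * (r - l ^+ 2) = q ^+ 2 -> eigenvalue (symbol p q r) l.
Proof.
move=> Hl.
have [s [t [st0 Hs Ht]]] : exists s t : R, [/\ (s != 0) || (t != 0),
    p * s + q * t = l ^+ 2 * s & q * s + r * t = l ^+ 2 * t].
  (* For q <> 0 the first row of the eigenvector equation determines (s, t)
     up to scaling; for q = 0 one of the basis vectors works. *)
  have [q0|q0] := eqVneq q 0; last first.
    exists q, (l ^+ 2 - p); split; first by rewrite q0.
      ring.
    by rewrite -expr2 -Hl; ring.
  move: Hl; rewrite q0 expr0n /= => /eqP; rewrite mulf_eq0 !subr_eq0.
  case/orP => /eqP <-; [exists 1, 0|exists 0, 1]; split; try ring.
    by rewrite oner_eq0.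
  by rewrite oner_eq0 orbT.
apply/eigenvalueP.
exists (\row_(j < 4) [:: l * s; l * t; - t; s]`_j); last first.
  apply: contraL st0 => /eqP/rowP h.
  have := h 3; have := h 2; rewrite !mxE /= => /eqP.
  by rewrite oppr_eq0 => /eqP -> ->; rewrite eqxx.
apply/rowP => j; rewrite mxE !big_ord_recr big_ord0 /= add0r !mxE /=.
case: j => [[|[|[|[|//]]]] hi] /=; rewrite ?mulr0 ?addr0 ?add0r //.
- by rewrite mulrA -expr2 -Hs; ring.
- by rewrite mulrA -expr2 -Ht; ring.
- ring.
- ring.
Qed.

(** * Uniform strict hyperbolicity from the spectrum at one point *)

(** Each coordinate is bounded by the Euclidean norm, so the Euclidean ball lies
    in the ball of the sup norm with the same radius. *)
Lemma nbhs0_euclidean_ball {R : realType} {n : nat} (U : set 'cV[R]_n) :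
  nbhs (0 : 'cV[R]_n) U -> exists2 d : R, 0 < d & @euclidean_ball R n d `<=` U.
Proof.
move=> /nbhs_ballP[d /= d0 dU]; exists d => // v /= vd.
apply: dU; split=> // i j; rewrite ord1 /ball /= mxE sub0r normrN.
apply: le_lt_trans vd; rewrite -sqrtr_sqr ler_wsqrtr //.
by rewrite (bigD1 i) //= lerDl sumr_ge0 // => k _; exact: sqr_ge0.
Qed.

Section simple_spectrum.
Context {R : realType} {a : 'cV[R]_4 -> 'M[R]_4} {lam : 'I_4 -> 'cV[R]_4 -> R}.
Context (lamC : forall i, lam i v @[v --> (0 : 'cV[R]_4)] --> lam i 0).
Context (lam0 : forall k l : 'I_4, (k < l)%N -> lam l 0 < lam k 0).
Context (lamE : \forall v \near (0 : 'cV[R]_4),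
  forall i, eigenvalue (a v) (lam i v)).

(* For [k < l], the values of [lam k] and [lam l] stay above and below the
   middle third of the interval between [lam l 0] and [lam k 0], which thus
   separates them uniformly in [v]. *)
Let gap (k l : 'I_4) : set 'cV[R]_4 := [set v | (k < l)%N ->
  (lam k 0 *+ 2 + lam l 0) / 3 < lam k v /\
  lam l v < (lam k 0 + lam l 0 *+ 2) / 3].

Let near_gap : \forall v \near (0 : 'cV[R]_4), forall k l, gap k l v.
Proof.
have near_gap_kl k l : \forall v \near (0 : 'cV[R]_4), gap k l v.
  have [kl|kl] := boolP (k < l)%N; last by near=> v; rewrite /gap /= (negbTE kl).
  have lt_kl := lam0 _ _ kl.
  have hk : (lam k 0 *+ 2 + lam l 0) / 3 < lam k 0 by lra.
  have hl : lam l 0 < (lam k 0 + lam l 0 *+ 2) / 3 by lra.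
  near=> v => _; split; near: v.
    exact: (cvgr_gt (lam k 0)) (lamC k) _ hk.
  exact: (cvgr_lt (lam l 0)) (lamC l) _ hl.
have FF : Filter (nbhs (0 : 'cV[R]_4)) by exact: nbhs_filter.
apply: (@filter_forall _ _ (fun k v => forall l, gap k l v) _ FF) => k.
exact: (@filter_forall _ _ (gap k) _ FF (near_gap_kl k)).
Unshelve. all: by end_near. Qed.

Let separated (v : 'cV[R]_4) :=
  (forall i, eigenvalue (a v) (lam i v)) /\ (forall k l, gap k l v).

Let separated_ordered : ordered_eigenvalues a separated lam.
Proof.
move=> v [Ev gv]; split=> // k l kl.
by have := lam0 _ _ kl; have [] := gv _ _ kl; lra.
Qed.

(** Eigenvalues that are continuous and distinct at 0 keep their order near 0. *)
Lemma ordered_eigenvalues_near :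
  exists2 U, nbhs (0 : 'cV[R]_4) U & ordered_eigenvalues a U lam.
Proof. by exists separated => //; exact: (filterI lamE near_gap). Qed.

(** Continuity at 0 alone makes the separation uniform: on a ball where [gap]
    holds for every pair, the infimum of [lam k] and the supremum of [lam l]
    differ by at least a third of [lam k 0 - lam l 0]. *)
Lemma uniformly_strictly_hyperbolic_near : exists delta : R,
  0 < delta /\ uniformly_strictly_hyperbolic a (euclidean_ball delta).
Proof.
have [d d0 dU] := nbhs0_euclidean_ball _ (filterI lamE near_gap).
exists d; split => //; exists lam; split.
  by move=> v /dU; exact: separated_ordered.
elim/big_ind: _ => [|x y x0 y0|[k l] /= kl]; first exact: ltry.
  by rewrite lt_min x0.
pose A := (lam k 0 *+ 2 + lam l 0) / 3; pose B := (lam k 0 + lam l 0 *+ 2) / 3.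
apply: (@lt_le_trans _ _ (A%:E - B%:E)%E).
  by rewrite -EFinB lte_fin /A /B; have := lam0 _ _ kl; lra.
apply: leeB.
- apply/ereal_infP => _ [v /dU[_ gv] <-].
  by rewrite lee_fin ltW //; case: (gv _ _ kl).
- apply/ereal_supP => _ [v /dU[_ gv] <-].
  by rewrite lee_fin ltW //; case: (gv _ _ kl).
Qed.

End simple_spectrum.

(** * Eigenvalues of a symmetric two-by-two matrix *)

Lemma is_diff_sqrt {R : realType} {V : normedModType R} (x : V) (f df : V -> R) :
  is_diff x f df -> 0 < f x ->
  is_diff x (fun y => Num.sqrt (f y)) (fun e => (2 * Num.sqrt (f x))^-1 * df e).
Proof.
move=> dfx fx0; have sqrt_fx := is_derive1_sqrt fx0.
have dsqrt : is_diff (f x) Num.sqrt ( *:%R^~ (2 * Num.sqrt (f x))^-1).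
  have sd : derivable (Num.sqrt : R -> R) (f x) 1 by [].
  apply: DiffDef; first exact/derivable1_diffP.
  by rewrite deriv1E // derive1E derive_val.
have -> : (fun e => (2 * Num.sqrt (f x))^-1 * df e) =
    *:%R^~ (2 * Num.sqrt (f x))^-1 \o df by apply/funext => e /=; rewrite mulrC.
exact: is_diff_comp.
Qed.

(** The roots of the characteristic polynomial of [(p q; q r)] by the quadratic
    formula: the larger one for [s = 1], the smaller one for [s = -1]. *)
Definition sym2_eigenvalue {R : realType} (s p q r : R) : R :=
  (p + r + s * Num.sqrt ((p - r) ^+ 2 + 4 * q ^+ 2)) / 2.

Lemma sym2_eigenvalueP {R : realType} (s p q r : R) : s ^+ 2 = 1 ->
  (p - sym2_eigenvalue s p q r) * (r - sym2_eigenvalue s p q r) = q ^+ 2.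
Proof.
move=> s1; rewrite /sym2_eigenvalue; set D := _ + 4 * q ^+ 2.
have : Num.sqrt D ^+ 2 = D.
  by rewrite sqr_sqrtr // addr_ge0 ?sqr_ge0 // mulr_ge0 ?sqr_ge0.
set w := Num.sqrt D => w2.
have -> : (p - (p + r + s * w) / 2) * (r - (p + r + s * w) / 2) =
  (s ^+ 2 * w ^+ 2 - (p - r) ^+ 2) / 4 by field.
by rewrite s1 w2 /D; field.
Qed.

Lemma sym2_eigenvalue_diag {R : realType} (s p r : R) : r < p ->
  sym2_eigenvalue s p 0 r = (p + r + s * (p - r)) / 2.
Proof.
move=> rp; rewrite /sym2_eigenvalue expr0n mulr0 addr0 sqrtr_sqr gtr0_norm //.
by rewrite subr_gt0.
Qed.

(** Where the matrix is diagonal, [q] contributes only to second order: the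
    discriminant [D] is [(p - r) ^+ 2] up to the square of [q], so the square
    root of [D] has the differential of [p - r], and the two eigenvalues those
    of [p] and [r]. *)
Lemma is_diff_sym2_eigenvalue {R : realType} {V : normedModType R} (s : R)
    (x : V) (p q r dp dq dr : V -> R) :
  is_diff x p dp -> is_diff x q dq -> is_diff x r dr ->
  q x = 0 -> r x < p x ->
  is_diff x (fun v => sym2_eigenvalue s (p v) (q v) (r v))
    (fun e => (dp e + dr e + s * (dp e - dr e)) / 2).
Proof.
move=> dpx dqx drx qx rp; have pr0 : 0 < p x - r x by rewrite subr_gt0.
have prx : (p x - r x) ^+ 2 + 4 * q x ^+ 2 = (p x - r x) ^+ 2.
  by rewrite qx expr0n mulr0 addr0.
pose D := (p - r) ^+ 2 + 4 *: q ^+ 2.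
have dD : is_diff x D (fun e => 2 * (p x - r x) * (dp e - dr e)).
  have dF := is_diffD (is_diffX 1 (is_diffB dpx drx))
    (is_diffZ 4 (is_diffX 1 dqx)).
  apply: is_diff_eq dF _; apply/funext => e.
  by rewrite !fctE qx mulr0 scale0r scaler0 addr0.
have Dx0 : 0 < D x by rewrite /D !fctE prx exprn_gt0.
have dS := is_diff_sqrt x D _ dD Dx0.
have -> : (fun v => sym2_eigenvalue s (p v) (q v) (r v)) =
    2^-1 *: (p + r + s *: (fun v => Num.sqrt (D v))).
  by apply/funext => v; rewrite /sym2_eigenvalue mulrC.
have dF := is_diffZ 2^-1 (is_diffD (is_diffD dpx drx) (is_diffZ s dS)).
apply: is_diff_eq dF _; apply/funext => e.
have -> : D x = (p x - r x) ^+ 2 by rewrite /D !fctE prx.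
rewrite sqrtr_sqr gtr0_norm // !fctE [RHS]mulrC; congr (2^-1 * _).
by congr (_ + s * _); field; rewrite gt_eqF.
Qed.

(** * The four characteristic speeds *)

(** The fastest and the slowest speed come from the larger eigenvalue of
    [(p q; q r)], the two in between from the smaller one. *)
Definition outer (i : 'I_4) := (i == 0) || (i == 3).

Definition speed {R : realType} (i : 'I_4) (p q r : R) : R :=
  (if (i < 2)%N then 1 else -1) *
  Num.sqrt (sym2_eigenvalue (if outer i then 1 else -1) p q r).

Section eigenvalue_branches.
Context {R : realType} {p q r dp dq dr : 'cV[R]_4 -> R}.
Context (dp0 : is_diff (0 : 'cV[R]_4) p dp) (dq0 : is_diff (0 : 'cV[R]_4) q dq).
Context (dr0 : is_diff (0 : 'cV[R]_4) r dr).
Context (q0 : q 0 = 0) (r_gt0 : 0 < r 0) (r_lt_p : r 0 < p 0).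

Let a v := symbol (p v) (q v) (r v).
Let lam i v := speed i (p v) (q v) (r v).
Let mu i v := sym2_eigenvalue (if outer i then 1 else -1) (p v) (q v) (r v).

Let mu0 i : mu i 0 = if outer i then p 0 else r 0.
Proof. by rewrite /mu q0 sym2_eigenvalue_diag //; case: ifP => _; field. Qed.

Let mu0_gt0 i : 0 < mu i 0.
Proof. by rewrite mu0; case: ifP => // _; exact: lt_trans r_lt_p. Qed.

Let lam_sqr i v : 0 < mu i v -> lam i v ^+ 2 = mu i v.
Proof.
move=> m0; rewrite exprMn sqr_sqrtr; last exact: ltW.
by rewrite -/(mu i v); case: ifP => _; ring.
Qed.

Let is_diff_mu i : is_diff (0 : 'cV[R]_4) (mu i) (if outer i then dp else dr).
Proof.
have dmu := is_diff_sym2_eigenvalue (if outer i then 1 else -1) _ _ _ _ _ _ _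
  dp0 dq0 dr0 q0 r_lt_p.
apply: is_diff_eq dmu _.
by apply/funext => e; case: ifP => _; field.
Qed.

(** This is [d l = d (l ^+ 2) / (2 l)], where [l ^+ 2] has differential [dp] or
    [dr] because [q] vanishes at 0. *)
Lemma is_diff_speed i : is_diff (0 : 'cV[R]_4) (lam i)
  (fun e => (2 * lam i 0)^-1 * (if outer i then dp else dr) e).
Proof.
have dS := is_diff_sqrt _ _ _ (is_diff_mu i) (mu0_gt0 i).
have -> : lam i = (if (i < 2)%N then 1 else -1) *: (fun v => Num.sqrt (mu i v)).
  by apply/funext.
apply: is_diff_eq (is_diffZ _ dS) _; apply/funext => e; rewrite !fctE.
set w := Num.sqrt _; case: ifP => _; rewrite ?scale1r ?scaleN1r //.
by rewrite mulrN invrN mulNr.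
Qed.

Lemma speed_ordered0 (k l : 'I_4) : (k < l)%N -> lam l 0 < lam k 0.
Proof.
have speedE i : lam i 0 = (if (i < 2)%N then 1 else -1) * Num.sqrt (mu i 0) by [].
have r1 : 0 < Num.sqrt (r 0) by rewrite sqrtr_gt0.
have r2 : Num.sqrt (r 0) < Num.sqrt (p 0).
  by rewrite ltr_sqrt // (lt_trans r_gt0).
rewrite !speedE !mu0.
by elim/ord4P: k; elim/ord4P: l => //= _; lra.
Qed.

(** [speed] squares to an eigenvalue of [(p q; q r)] only where the latter is
    nonnegative, which holds near 0 by continuity. *)
Lemma eigenvalue_speed_near : \forall v \near (0 : 'cV[R]_4),
  forall i, eigenvalue (a v) (lam i v).
Proof.
have FF : Filter (nbhs (0 : 'cV[R]_4)) by exact: nbhs_filter.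
apply: (@filter_forall _ _ (fun i v => eigenvalue (a v) (lam i v)) _ FF) => i.
have muC : mu i v @[v --> (0 : 'cV[R]_4)] --> mu i 0.
  by apply: differentiable_continuous; have [] := is_diff_mu i.
near=> v.
have mu_gt0 : 0 < mu i v by near: v; exact: (cvgr_gt (mu i 0)) muC _ (mu0_gt0 i).
apply: eigenvalue_symbol.
rewrite lam_sqr //.
by apply: sym2_eigenvalueP; case: ifP => _; ring.
Unshelve. all: by end_near. Qed.

(** Since [q] vanishes at 0, the eigenvector equation reduces to
    [(p 0 - l ^+ 2) * e_0 = 0] and [(r 0 - l ^+ 2) * e_1 = 0], and [e_0], [e_1]
    cannot both vanish because they determine [e_2] and [e_3]. *)
Lemma speed_eigenvector i (e : 'cV[R]_4) : e != 0 ->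
  a 0 *m e = lam i 0 *: e ->
  if outer i then e 0 0 != 0 /\ e 1 0 = 0 else e 0 0 = 0 /\ e 1 0 != 0.
Proof.
move=> e0 /col4P.
have [-> -> -> ->] := symbol_mul_col (p 0) (q 0) (r 0) e.
rewrite !mxE q0 !mul0r add0r addr0 => -[E0 E1 E2 E3].
have lam2 := lam_sqr i 0 (mu0_gt0 i).
have H0 : (p 0 - mu i 0) * e 0 0 = 0.
  by rewrite -lam2 mulrBl E3 E0; ring.
have H1 : (r 0 - mu i 0) * e 1 0 = 0.
  have e2 : e 2 0 = - (lam i 0 * e 1 0) by rewrite -E1 opprK.
  by rewrite -lam2 mulrBl -[r 0 * _]opprK E2 e2; ring.
have nz : ~~ ((e 0 0 == 0) && (e 1 0 == 0)).
  apply: contra e0 => /andP[/eqP h0 /eqP h1]; apply/eqP/col4P; rewrite !mxE h0 h1.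
  move: E0 E1; rewrite h0 h1 !mulr0 => -> /eqP.
  by rewrite oppr_eq0 => /eqP ->.
move: H0 H1 nz; rewrite mu0.
case: ifP => _ /eqP + /eqP.
  rewrite !mulf_eq0 !subr_eq0 eqxx /= (lt_eqF r_lt_p) /= => _ /eqP ->.
  by rewrite eqxx andbT.
rewrite !mulf_eq0 !subr_eq0 eqxx /= (gt_eqF r_lt_p) /= => /eqP -> _.
by rewrite eqxx.
Qed.

Let lamC i : lam i v @[v --> (0 : 'cV[R]_4)] --> lam i 0.
Proof. by apply: differentiable_continuous; have [] := is_diff_speed i. Qed.

Lemma symbol_hyperbolic : exists delta : R,
  0 < delta /\ uniformly_strictly_hyperbolic a (euclidean_ball delta).
Proof.
exact: uniformly_strictly_hyperbolic_near lamC speed_ordered0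
  eigenvalue_speed_near.
Qed.

Lemma symbol_genuinely_nonlinear :
  (forall e : 'cV[R]_4, e 0 0 != 0 -> e 1 0 = 0 -> dp e != 0) ->
  (forall e : 'cV[R]_4, e 0 0 = 0 -> e 1 0 != 0 -> dr e != 0) ->
  genuinely_nonlinear a.
Proof.
move=> dp_neq0 dr_neq0.
have [U U0 ordU] := ordered_eigenvalues_near lamC speed_ordered0
  eigenvalue_speed_near.
exists U, lam; split; [exact: U0|exact: ordU|move=> i].
have dlam := is_diff_speed i.
split=> [|e e0 /(speed_eigenvector _ _ e0) ev]; first exact: ex_diff.
rewrite diff_val mulf_neq0 // ?invr_eq0.
  rewrite mulf_neq0 ?pnatr_eq0 // -sqrf_eq0 lam_sqr ?mu0_gt0 //.
  by rewrite gt_eqF ?mu0_gt0.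
by move: ev; case: ifP => _ [h0 h1]; [exact: dp_neq0|exact: dr_neq0].
Qed.

End eigenvalue_branches.

(** * The Maxwell system *)

(** A coordinate is linear, so it is its own differential; the value is read off
    from the derivative of the identity, which is taken entrywise. *)
Lemma is_diff_coord {R : realType} {m n : nat} (M : 'M[R]_(m, n)) i j :
  is_diff M (fun N => N i j : R) (fun N => N i j).
Proof.
apply: DiffDef; first exact: differentiable_coord.
apply/funext => e; rewrite -deriveE; last exact: differentiable_coord.
have /matrixP/(_ i j) := derive_id M e.
by rewrite derive_mx ?mxE //; exact: derivable_id.
Qed.

Lemma is_derive_quadratic {R : realType} (f g : R -> R) (x df dg A B C D : R) :
  is_derive x 1 f df -> is_derive x 1 g dg ->
  is_derive x 1
    (fun y => A * f y + B * f y ^+ 2 + C * f y * g y + D * g y ^+ 2)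
    (A * df + 2 * B * f x * df + C * (f x * dg + g x * df) + 2 * D * g x * dg).
Proof.
move=> dfx dgx.
have -> : (fun y => A * f y + B * f y ^+ 2 + C * f y * g y + D * g y ^+ 2) =
    A \*: f + B \*: f ^+ 2 + C \*: (f * g) + D \*: g ^+ 2.
  by apply/funext => y; rewrite -[C * _ * _]mulrA.
have H := is_deriveD (is_deriveD (is_deriveD (is_deriveZ A dfx)
    (is_deriveZ B (is_deriveX 2 dfx))) (is_deriveZ C (is_deriveM dfx dgx)))
  (is_deriveZ D (is_deriveX 2 dgx)).
apply: is_derive_eq H _.
rewrite /GRing.scale /= !expr1; ring.
Qed.

Lemma derive1_state {R : realType} (f0 f1 f2 f3 : R -> R) (x : R) :
  derivable f0 x 1 -> derivable f1 x 1 -> derivable f2 x 1 -> derivable f3 x 1 ->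
  derive1 (fun y => \col_(i < 4) [:: f0 y; f1 y; f2 y; f3 y]`_i : 'cV[R]_4) x =
  \col_(i < 4) [:: derive1 f0 x; derive1 f1 x; derive1 f2 x; derive1 f3 x]`_i.
Proof.
move=> d0 d1 d2 d3.
have derivable_ext (f g : R -> R) :
    derivable f x 1 -> f =1 g -> derivable g x 1.
  by move=> ? /funext <-.
rewrite derive1E derive_mx; last first.
  apply/derivable_mxP => i j; rewrite ord1; elim/ord4P: i.
  - by apply: (derivable_ext f0) => // y; rewrite mxE.
  - by apply: (derivable_ext f1) => // y; rewrite mxE.
  - by apply: (derivable_ext f2) => // y; rewrite mxE.
  - by apply: (derivable_ext f3) => // y; rewrite mxE.
apply/matrixP => i j; rewrite !mxE ord1; elim/ord4P: i => /=.
all: by rewrite derive1E; congr ('D_1 _ x); apply/funext => y; rewrite mxE.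
Qed.

Section maxwell_system.
Context {R : realType} (K1 K2 C111 C112 C122 C222 : R).

(* The second derivatives of the energy density with respect to D. *)
Let E_yy (v : 'cV[R]_4) := K1 + 6 * C111 * v 0 0 + 2 * C112 * v 1 0.
Let E_yz (v : 'cV[R]_4) := 2 * C112 * v 0 0 + 2 * C122 * v 1 0.
Let E_zz (v : 'cV[R]_4) := K2 + 2 * C122 * v 0 0 + 6 * C222 * v 1 0.

Definition maxwell_symbol (v : 'cV[R]_4) : 'M[R]_4 :=
  symbol (E_yy v) (E_yz v) (E_zz v).

Let is_diff_affine (c A B : R) :
  is_diff (0 : 'cV[R]_4) (fun v => c + A * v 0 0 + B * v 1 0)
    (fun e => A * e 0 0 + B * e 1 0).
Proof.
have d0 := is_diff_coord (0 : 'cV[R]_4) 0 0.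
have d1 := is_diff_coord (0 : 'cV[R]_4) 1 0.
have -> : (fun v : 'cV[R]_4 => c + A * v 0 0 + B * v 1 0) =
  cst c + A *: (fun v => v 0 0) + B *: (fun v => v 1 0) by [].
have dF := is_diffD (is_diffD (is_diff_cst c 0) (is_diffZ A d0)) (is_diffZ B d1).
by apply: is_diff_eq dF _; apply/funext => e; rewrite !fctE add0r.
Qed.

(** The chain rule turns the derivatives of [E_y] and [E_z] into the rows of the
    Hessian applied to the derivatives of [Dy] and [Dz]; both sides are then the
    same four scalar equations. *)
Lemma maxwell_quasilinear (Dy Dz By Bz : R -> R -> R) (x t : R) :
  has_partials Dy x t -> has_partials Dz x t ->
  has_partials By x t -> has_partials Bz x t ->
  maxwell K1 K2 C111 C112 C122 C222 Dy Dz By Bz x t <->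
  quasilinear maxwell_symbol (state Dy Dz By Bz) x t.
Proof.
move=> [yx yt] [zx zt] [byx byt] [bzx bzt].
have dyx := derivableP yx; have dzx := derivableP zx.
have EyE : dx (fun y s => E_y K1 C111 C112 C122 (Dy y s) (Dz y s)) x t =
    E_yy (state Dy Dz By Bz x t) * dx Dy x t +
    E_yz (state Dy Dz By Bz x t) * dx Dz x t.
  rewrite /dx !derive1E /E_y /E_yy /E_yz !mxE /=.
  have := is_derive_quadratic _ _ x _ _ K1 (3 * C111) (2 * C112) C122 dyx dzx.
  by move=> /@derive_val ->; ring.
have EzE : dx (fun y s => E_z K2 C112 C122 C222 (Dy y s) (Dz y s)) x t =
    E_yz (state Dy Dz By Bz x t) * dx Dy x t +
    E_zz (state Dy Dz By Bz x t) * dx Dz x t.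
  rewrite /dx !derive1E /E_z /E_zz /E_yz !mxE /=.
  (* E_z has the shape of E_y with the roles of Dy and Dz exchanged. *)
  have := is_derive_quadratic _ _ x _ _ K2 (3 * C222) (2 * C122) C112 dzx dyx.
  rewrite [X in is_derive x 1 X](_ : _ = fun y => K2 * Dz y t +
    C112 * Dy y t ^+ 2 + 2 * C122 * Dy y t * Dz y t + 3 * C222 * Dz y t ^+ 2).
    by move=> /@derive_val ->; ring.
  by apply/funext => y; ring.
rewrite /maxwell /quasilinear EyE EzE.
have -> : dx (state Dy Dz By Bz) x t =
  \col_(i < 4) [:: dx Dy x t; dx Dz x t; dx By x t; dx Bz x t]`_i.
  rewrite /dx /state; exact: derive1_state yx zx byx bzx.
have -> : dt (state Dy Dz By Bz) x t =
  \col_(i < 4) [:: dt Dy x t; dt Dz x t; dt By x t; dt Bz x t]`_i.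
  rewrite /dt /state; exact: derive1_state yt zt byt bzt.
move: (state _ _ _ _ x t) => u.
apply: (iff_trans _ (iff_sym (symbol_system _ _ _ _ _))).
have colE (w : seq R) i : (\col_(i < 4) w`_i : 'cV[R]_4) i 0 = w`_i.
  by rewrite mxE.
by rewrite 8!colE.
Qed.

Context (K2_gt0 : 0 < K2) (K2_lt_K1 : K2 < K1).

Let E_yy0 : E_yy 0 = K1. Proof. by rewrite /E_yy !mxE; ring. Qed.
Let E_yz0 : E_yz 0 = 0. Proof. by rewrite /E_yz !mxE; ring. Qed.
Let E_zz0 : E_zz 0 = K2. Proof. by rewrite /E_zz !mxE; ring. Qed.
Let is_diff_E_yy := is_diff_affine K1 (6 * C111) (2 * C112).
Let is_diff_E_zz := is_diff_affine K2 (2 * C122) (6 * C222).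
Let is_diff_E_yz : is_diff (0 : 'cV[R]_4) E_yz
  (fun e => 2 * C112 * e 0 0 + 2 * C122 * e 1 0).
Proof.
have -> : E_yz = fun v => 0 + 2 * C112 * v 0 0 + 2 * C122 * v 1 0.
  by apply/funext => v; rewrite add0r.
exact: is_diff_affine.
Qed.

Let E_zz_gt0 : 0 < E_zz 0. Proof. by rewrite E_zz0. Qed.
Let E_zz_lt_yy : E_zz 0 < E_yy 0. Proof. by rewrite E_zz0 E_yy0. Qed.

Lemma maxwell_hyperbolic : exists delta : R,
  0 < delta /\
  uniformly_strictly_hyperbolic maxwell_symbol (euclidean_ball delta).
Proof.
exact: (symbol_hyperbolic is_diff_E_yy is_diff_E_yz is_diff_E_zz
  E_yz0 E_zz_gt0 E_zz_lt_yy).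
Qed.

Lemma maxwell_genuinely_nonlinear :
  C111 != 0 -> C222 != 0 -> genuinely_nonlinear maxwell_symbol.
Proof.
move=> C1 C2.
apply: (symbol_genuinely_nonlinear is_diff_E_yy is_diff_E_yz is_diff_E_zz
  E_yz0 E_zz_gt0 E_zz_lt_yy).
- by move=> e e0 ->; rewrite mulr0 addr0 !mulf_neq0 // pnatr_eq0.
- by move=> e -> e1; rewrite mulr0 add0r !mulf_neq0 // pnatr_eq0.
Qed.

End maxwell_system.

Theorem lemma5 (R : realType) (K1 K2 C111 C112 C122 C222 : R) :
  exists a : 'cV[R]_4 -> 'M[R]_4,
    (forall (Dy Dz By Bz : R -> R -> R) (x t : R),
        has_partials Dy x t -> has_partials Dz x t ->
        has_partials By x t -> has_partials Bz x t ->
        (maxwell K1 K2 C111 C112 C122 C222 Dy Dz By Bz x t <->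
         quasilinear a (state Dy Dz By Bz) x t)) /\
    (0 < K2 -> K2 < K1 -> K1 < 1 ->
       (exists delta : R, 0 < delta /\
          uniformly_strictly_hyperbolic a (euclidean_ball delta)) /\
       (C111 != 0 -> C222 != 0 -> genuinely_nonlinear a)).
Proof.
exists (maxwell_symbol K1 K2 C111 C112 C122 C222).
split; first exact: maxwell_quasilinear.
move=> K2_gt0 K2_lt_K1 _; split; first exact: maxwell_hyperbolic.
exact: maxwell_genuinely_nonlinear.
Qed.
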